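(* Let $M,N,L\ge1$ be integers, $\alpha_{\rm c},\alpha_{\rm s}>0$, let $\mathbf h_{\rm s}\in\mathbb C^{M\times1}$ be a fixed nonzero vector, and let $\mathbf h_{\rm c}\sim\mathcal{CN}(\mathbf 0,\alpha_{\rm c}\mathbf I)$ be a random vector in $\mathbb C^{M\times1}$. For $p>0$ let $$\mathcal R_{\rm s}^{\rm c}=\mathbb E\left\{\frac1L\log_2\!\left(1+pNL\alpha_{\rm s}\frac{|\mathbf h_{\rm c}^{\mathsf H}\mathbf h_{\rm s}|^2}{\lVert\mathbf h_{\rm c}\rVert^2}\right)\right\}$$ be the average sensing rate of the communications-centric design. Then, as $p\to\infty$, $$\mathcal R_{\rm s}^{\rm c}\approx\frac1L\left(\log_2 p+\log_2\!\left(LN\alpha_{\rm s}\lVert\mathbf h_{\rm s}\rVert^2\right)-\sum_{i=1}^{M-1}\frac{1}{i\ln2}\right).$$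
   Context: A base station with $M$ transmit and $N$ receive antennas sends a length-$L$ signal $\sqrt p\,\mathbf w\mathbf s^{\mathsf H}$ with power budget $p$ and unit-norm beamformer $\mathbf w\in\mathbb C^{M\times1}$, serving a single-antenna user with channel $\mathbf h_{\rm c}$ and sensing one target of average reflection strength $\alpha_{\rm s}$. The sensing rate of beamformer $\mathbf w$ is $\mathcal R_{\rm s}=L^{-1}\log_2(1+pNL\alpha_{\rm s}|\mathbf w^{\mathsf H}\mathbf h_{\rm s}|^2)$, where $\mathbf h_{\rm s}$ is the (deterministic, nonzero) transmit array steering vector toward the target. The communications-centric design uses $\mathbf w=\mathbf w_{\rm c}=\mathbf h_{\rm c}/\lVert\mathbf h_{\rm c}\rVert$. $\mathcal{CN}(\mathbf 0,\alpha_{\rm c}\mathbf I)$ is the circularly symmetric complex Gaussian law: i.i.d. entries with mean zero and variance $\mathbb E|\cdot|^2=\alpha_{\rm c}$. Empty sums are zero. For rates, ''$\approx$ as $p\to\infty$'' means that the difference of the two sides tends to $0$. *)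

(* Defs.v *)
From HB Require Import structures.
From mathcomp Require Import all_boot all_order all_algebra.
From mathcomp Require Import complex.
From mathcomp Require Import all_classical all_reals all_analysis.

Set Implicit Arguments.
Unset Strict Implicit.
Unset Printing Implicit Defensive.
Import Order.TTheory GRing.Theory Num.Theory.
Import numFieldNormedType.Exports.

Local Open Scope classical_set_scope.
Local Open Scope ring_scope.

Definition log2 (R : realType) (x : R) : R := ln x / ln 2.

Definition adjoint (R : rcfType) (m n : nat) (A : 'M[R[i]]_(m, n))
  : 'M[R[i]]_(n, m) := (map_mx Num.conj A)^T.

Definition modulus (R : rcfType) (z : R[i]) : R := ComplexField.Normc.normc z.

(* The Euclidean norm: the norm that the library puts on matrices is the
   maximum norm, and the norm `|z| of z : R[i] is itself an element of R[i]. *)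
Definition norm2 (R : rcfType) (M : nat) (v : 'cV[R[i]]_M) : R :=
  Num.sqrt (\sum_(i < M) modulus (v i 0) ^+ 2).

Definition mutually_independent (R : realType)
    (d : measure_display) (T : measurableType d) (P : probability T R)
    (d' : measure_display) (S : measurableType d')
    (I : finType) (X : I -> T -> S) : Prop :=
  forall (J : {set I}) (B : I -> set S), (forall i, measurable (B i)) ->
    P (\bigcap_(i in [set i | i \in J]) (X i @^-1` B i)) =
    (\prod_(i in J) P (X i @^-1` B i))%E.

(* Complex-valued random variables are measured through R[i] = R * R, with the
   product sigma-algebra. *)
Definition reim (R : realType) (z : R[i]) : R * R :=
  (complex.Re z, complex.Im z).

(* CN(0, alpha): the real and imaginary parts are independent, each with law
   N(0, alpha / 2), so that E|z|^2 = alpha. The second parameter of normal_prob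
   is the standard deviation. *)
Definition circular_gaussian_law (R : realType) (alpha : R)
  : set (R * R) -> \bar R :=
  (normal_prob 0 (Num.sqrt (alpha / 2)) \x
   normal_prob 0 (Num.sqrt (alpha / 2)))%E.

Definition circular_gaussian_vector (R : realType)
    (d : measure_display) (T : measurableType d) (P : probability T R)
    (M : nat) (alpha : R) (h : T -> 'cV[R[i]]_M) : Prop :=
  let X (i : 'I_M) (t : T) : R * R := reim (h t i 0) in
  [/\ forall i, measurable_fun setT (X i),
      forall (i : 'I_M) (B : set (R * R)), measurable B ->
        pushforward P (X i) B = circular_gaussian_law alpha B
    & mutually_independent P X].

(* R_s^c, in the extended reals because that is where the library puts
   expectations. *)
Definition cc_sensing_rate (R : realType)
    (d : measure_display) (T : measurableType d) (P : probability T R)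
    (M N L : nat) (alpha_s : R) (hs : 'cV[R[i]]_M) (hc : T -> 'cV[R[i]]_M)
    (p : R) : \bar R :=
  'E_P[(fun t => L%:R^-1 *
    log2 (1 + p * N%:R * L%:R * alpha_s *
      (modulus ((adjoint (hc t) *m hs) 0 0) ^+ 2 / norm2 (hc t) ^+ 2)))%R]%E.

(* Main.v *)
(** Write Z = sum_i conj(h_i) v_i and W = ||h||^2 for the Gaussian vector h and
the steering vector v. Frullani's formula turns E ln (1 + q |Z|^2 / W) into the
integral over t > 0 of (E exp(-t W) - E exp(-t (W + q |Z|^2))) / t, so only the
Laplace transforms of quadratic forms in h are needed, and neither the law of
the ratio nor unitary invariance. Integrating out one coordinate of h at a
time, which changes only the coefficient of |Z|^2, gives
  E exp(-t W - r |Z|^2) = A / (A^M (A + alpha r ||v||^2)),  A = 1 + alpha t.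
With kappa = q ||v||^2 and n = M - 1, the remaining integral F_n(kappa) is
elementary: F_0 = ln (1 + kappa) and F_(n+1) = F_n (1 + 1/kappa) - 1/(n+1),
whence F_n(kappa) - ln kappa tends to - (1 + 1/2 + ... + 1/n). *)

Require Import Defs.
From HB Require Import structures.
From mathcomp Require Import all_boot all_order all_algebra.
From mathcomp Require Import complex.
From mathcomp Require Import all_classical all_reals all_analysis.
From mathcomp Require Import measurable_realfun ring.

Import Order.TTheory GRing.Theory Num.Theory.
Import numFieldNormedType.Exports.

Local Open Scope classical_set_scope.
Local Open Scope ring_scope.

Set Implicit Arguments.
Unset Strict Implicit.

(** * One-dimensional Gaussian integrals *)

(** Change of variables holds with the Radon-Nikodym derivative; that derivative and [normal_pdf]
    have the same integral over every measurable set, hence agree almost everywhere. *)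
Lemma ge0_integral_normal_prob (R : realType) (m s : R) (f : R -> \bar R) :
  measurable_fun setT f -> (forall x, 0 <= f x)%E ->
  (\int[normal_prob m s]_x f x =
   \int[lebesgue_measure]_x (f x * (normal_pdf m s x)%:E))%E.
Proof.
move=> mf f0; have dom := @normal_prob_dominates R m s.
have mpdf : measurable_fun setT (EFin \o normal_pdf m s).
  by apply/measurable_EFinP; exact: measurable_normal_pdf.
rewrite -(Radon_Nikodym_SigmaFinite.change_of_variables dom)//.
apply: ge0_ae_eq_integral => //.
- apply: emeasurable_funM => //.
  by have /integrableP[] := Radon_Nikodym_SigmaFinite.f_integrable dom.
- exact: emeasurable_funM.
- by move=> x _; rewrite mule_ge0// Radon_Nikodym_SigmaFinite.f_ge0.
- by move=> x _; rewrite mule_ge0// lee_fin normal_pdf_ge0.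
- apply: ae_eqe_mul2l; apply: integral_ae_eq => //.
  + exact: Radon_Nikodym_SigmaFinite.f_integrable.
  + by move=> A _ mA; rewrite -Radon_Nikodym_SigmaFinite.f_integral.
Qed.

(** Completing the square turns the integrand times the density into a constant times another normal
    density, whose integral is 1. *)
Lemma integral_normal_prob_expR (R : realType) (s b c : R) :
  0 < s -> 0 < 1 + 2 * b * s ^+ 2 ->
  (\int[normal_prob 0 s]_x (expR (- (b * x ^+ 2 + c * x)))%:E =
   ((Num.sqrt (1 + 2 * b * s ^+ 2))^-1 *
     expR (c ^+ 2 * s ^+ 2 / (2 * (1 + 2 * b * s ^+ 2))))%:E)%E.
Proof.
move=> s0; set D := 1 + _ => D0.
have sD0 : 0 < Num.sqrt D by rewrite sqrtr_gt0.
have sDE : Num.sqrt D ^+ 2 = D by rewrite sqr_sqrtr// ltW.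
(* Deviation and mean of the Gaussian left after completing the square in
   [b x^2 + c x + x^2 / (2 s^2)]. *)
set s' := s / Num.sqrt D; set m' := - c * s ^+ 2 / D.
have s'0 : 0 < s' by rewrite divr_gt0.
rewrite ge0_integral_normal_prob//; last first.
  apply/measurable_EFinP; apply: measurableT_comp => //.
  apply: measurableT_comp => //; apply: measurable_funD => //.
    exact: measurable_funM.
set K := (X in _ = X%:E).
transitivity (\int[lebesgue_measure]_x (K%:E * (normal_pdf m' s' x)%:E))%E.
  apply: eq_integral => x _; rewrite -!EFinM; congr EFin.
  have peakE : normal_peak s' = normal_peak s * Num.sqrt D.
    rewrite /normal_peak (_ : s' ^+ 2 * pi *+ 2 = (s ^+ 2 * pi *+ 2) / D).
      rewrite sqrtrM ?sqrtrV ?invfM ?invrK// ltW//.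
      by rewrite ?mulrn_wgt0 ?mulr_gt0 ?pi_gt0 ?exprn_gt0.
    rewrite /s' expr_div_n sDE; ring.
  rewrite !normal_pdfE ?gt_eqF// peakE /K mulrCA.
  transitivity (normal_peak s * (Num.sqrt D / Num.sqrt D) *
    (expR (c ^+ 2 * s ^+ 2 / (2 * D)) * normal_fun m' s' x)); last by ring.
  rewrite divff ?gt_eqF// mulr1 /normal_fun -!expRD; congr (_ * expR _).
  rewrite /m' /s' expr_div_n sDE /D; field.
  by rewrite -/D !gt_eqF.
rewrite ge0_integralZl//.
- by rewrite integral_normal_pdf mule1.
- by apply/measurable_EFinP; exact: measurable_normal_pdf.
- by move=> x _; rewrite lee_fin normal_pdf_ge0.
- by rewrite lee_fin mulr_ge0 ?expR_ge0// invr_ge0 sqrtr_ge0.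
Qed.

(** * Folding an independent family one variable at a time *)

(** Rectangles are stable under intersection and generate the product sigma-algebra. *)
Lemma eq_measure_setX (R : realType) d1 d2 (U : measurableType d1)
    (S : measurableType d2) (m1 m2 : {measure set (U * S) -> \bar R}) :
  (m1 setT < +oo)%E ->
  (forall A B, measurable A -> measurable B -> m1 (A `*` B) = m2 (A `*` B)) ->
  forall C, measurable C -> m1 C = m2 C.
Proof.
move=> m1oo m12 C mC.
pose G : set (set (U * S)) := [set A `*` B | A in measurable & B in measurable].
apply: (measure_unique G (fun=> setT)) => //.
- exact: measurable_prod_measurableType.
- move=> _ _ [A1 mA1 [B1 mB1 <-]] [A2 mA2 [B2 mB2 <-]].
  rewrite -setXI; exists (A1 `&` A2); first exact: measurableI.
  by exists (B1 `&` B2) => //; exact: measurableI.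
- by move=> _; exists setT => //; exists setT => //; rewrite setXTT.
- by rewrite bigcup_const.
- by move=> _ [A mA [B mB <-]]; exact: m12.
Qed.

Section independent_fold.
Context (R : realType) d (T : measurableType d) (P : probability T R)
  d' (S : measurableType d') d'' (U : measurableType d'') (I : finType).
Variables (X : I -> T -> S) (g : I -> U * S -> U) (y0 : U).
Hypotheses (mX : forall i, measurable_fun setT (X i))
  (mg : forall i, measurable_fun setT (g i))
  (indX : mutually_independent P X).

(** A fold keeps only a running state in [U], so a variable can be integrated out at each induction
    step without a product space indexed by [I]. Each [g i] takes a pair so that its joint
    measurability can be assumed. *)
Definition fold_rv (s : seq I) (t : T) : U :=
  foldr (fun i y => g i (y, X i t)) y0 s.

Lemma measurable_fold_rv s : measurable_fun setT (fold_rv s).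
Proof.
elim: s => [|i s IHs]; first exact: measurable_cst.
apply: (measurableT_comp (f := g i) (g := fun t => (fold_rv s t, X i t))) => //.
exact: measurable_fun_pair.
Qed.

Let cylinder (J : {set I}) (B : I -> set S) :=
  \bigcap_(i in [set i | i \in J]) (X i @^-1` B i).

Let measurable_cylinder J B : (forall i, measurable (B i)) ->
  measurable (cylinder J B).
Proof.
move=> mB; apply: fin_bigcap_measurable => [|i _].
  exact: finite_finset.
by rewrite -[_ @^-1` _]setTI; exact: mX.
Qed.

Let cylinderU1 i (J : {set I}) (B : I -> set S) C : i \notin J ->
  cylinder (i |: J)%SET (fun j => if j == i then C else B j) =
  X i @^-1` C `&` cylinder J B.
Proof.
move=> iJ; apply/seteqP; split => [t h|t [hi hJ] j /=].
  split=> [|j jJ]; first by have := h i; rewrite /= eqxx; apply; rewrite setU11.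
  have := h j; rewrite /=; case: eqVneq => [ji|_].
    by move: jJ iJ; rewrite /= ji => ->.
  by apply; rewrite setU1r.
by rewrite in_setU1; case: eqVneq => [->|_]//= jJ; exact: hJ.
Qed.

Let prodU1 i (J : {set I}) (B : I -> set S) C : i \notin J ->
  (\prod_(j in (i |: J)%SET) P (X j @^-1` (if j == i then C else B j)) =
   P (X i @^-1` C) * \prod_(j in J) P (X j @^-1` B j))%E.
Proof.
move=> iJ; rewrite big_setU1//= eqxx; congr (_ * _)%E.
by apply: eq_bigr => j jJ; case: eqVneq => // ji; rewrite -ji jJ in iJ.
Qed.

(* Both sides, as functions of the event on the pair (fold over s, X i), are
   finite measures, so it suffices to compare them on rectangles, where the
   constraint on X i joins those of J. *)
Lemma fold_rv_independent (s : seq I) (J : {set I}) (B : I -> set S)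
    (A : set U) :
  uniq s -> (forall i, i \in s -> i \notin J) ->
  (forall i, measurable (B i)) -> measurable A ->
  P (fold_rv s @^-1` A `&` cylinder J B) =
  (P (fold_rv s @^-1` A) * \prod_(i in J) P (X i @^-1` B i))%E.
Proof.
elim: s J B A => [|i s IHs] J B A /=.
  move=> _ _ mB mA; rewrite -indX// -/(cylinder J B).
  (* The empty fold is constant, so its event is either certain or impossible. *)
  have [y0A|y0A] := pselect (A y0).
    rewrite (_ : fold_rv [::] @^-1` A = setT) ?setTI ?probability_setT ?mul1e//.
    by apply/seteqP; split => // t.
  rewrite (_ : fold_rv [::] @^-1` A = set0) ?set0I ?measure0 ?mul0e//.
  by apply/seteqP; split => // t.
move=> /andP[is_ us] sJ mB mA.
have iJ : i \notin J by apply: sJ; rewrite mem_head.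
have sJ' j : j \in s -> j \notin J.
  by move=> js; apply: sJ; rewrite in_cons js orbT.
pose W t := (fold_rv s t, X i t).
have mW : measurable_fun setT W.
  by apply: measurable_fun_pair => //; exact: measurable_fold_rv.
pose W' : {mfun T >-> (U * S)%type} := mfun_Sub (mem_set mW).
have mE := measurable_cylinder J mB.
set c := (\prod_(j in J) _)%E.
have mXB (C : set S) j : measurable C -> measurable (X j @^-1` C).
  by move=> mC; rewrite -[_ @^-1` _]setTI; exact: mX.
have cfin : c \is a fin_num.
  by apply: prode_fin_num => j _; rewrite fin_num_measure//; exact: mXB.
have c0 : (0 <= c)%E by apply: prode_ge0 => j _; exact: measure_ge0.
(* [m1] is the law of [W] restricted to the cylinder event, [m2] the full law of [W] scaled by the
   probability of that event. *)
pose m1 := measure_function_pushforward__canonical__measure_function_Measure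
  (mrestr P mE) mW.
pose m2 := mscale (NngNum (fine_ge0 c0)) (distribution P W').
have m1E C : m1 C = P (W @^-1` C `&` cylinder J B) by [].
have m2E C : m2 C = (P (W @^-1` C) * c)%E.
  by rewrite /m2 /mscale /= fineK// muleC.
have mgA : measurable (g i @^-1` A) by rewrite -[_ @^-1` _]setTI; exact: mg.
suff m12 : forall C, measurable C -> m1 C = m2 C.
  exact: etrans (m12 _ mgA) (m2E _).
apply: eq_measure_setX => [|A1 B1 mA1 mB1].
  by rewrite m1E preimage_setT setTI -ge0_fin_numE// fin_num_measure.
rewrite m1E [RHS]m2E.
have rect (J' : {set I}) (B' : I -> set S) :
    i \notin J' -> (forall j, j \in s -> j \notin J') ->
    (forall j, measurable (B' j)) ->
    P (W @^-1` (A1 `*` B1) `&` cylinder J' B') =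
    (P (fold_rv s @^-1` A1) *
     (P (X i @^-1` B1) * \prod_(j in J') P (X j @^-1` B' j)))%E.
  move=> iJ' sJ'' mB'.
  rewrite -prodU1// -(IHs _ (fun j => if j == i then B1 else B' j))//.
  - by rewrite cylinderU1// setIA.
  - move=> j js; rewrite in_setU1 negb_or sJ''// andbT.
    by apply: contraNneq is_ => <-.
  - by move=> j; case: ifP.
rewrite rect// muleA; congr (_ * _)%E.
(* With no constraint left, [rect] also factors the probability that [W] lies in the rectangle. *)
have := rect finset.set0 B; rewrite big_set0 mule1 => <-//.
- rewrite (_ : cylinder _ _ = setT) ?setIT//.
  by rewrite -subTset => t _ j; rewrite /= inE.
- by rewrite inE.
- by move=> j; rewrite inE.
Qed.

(** By independence the law of the pair (fold over [s], [X i]) is a product measure, and Tonelli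
    integrates out [X i] first. *)
Lemma integral_fold_rv_cons (i : I) (s : seq I) (h : U -> \bar R)
    (mu : probability S R) :
  uniq (i :: s) -> measurable_fun setT h -> (forall y, 0 <= h y)%E ->
  (forall B, measurable B -> P (X i @^-1` B) = mu B) ->
  (\int[P]_t h (fold_rv (i :: s) t) =
   \int[P]_t \int[mu]_x h (g i (fold_rv s t, x)))%E.
Proof.
move=> /= /andP[is_ us] mh h0 Xmu.
pose W t := (fold_rv s t, X i t).
have mW : measurable_fun setT W.
  by apply: measurable_fun_pair => //; exact: measurable_fold_rv.
pose W' : {mfun T >-> (U * S)%type} := mfun_Sub (mem_set mW).
pose F' : {mfun T >-> U} := mfun_Sub (mem_set (measurable_fold_rv s)).
have mhg : measurable_fun setT (h \o g i) by exact: measurableT_comp.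
have law C : measurable C ->
    distribution P W' C = (distribution P F' \x mu)%E C.
  move=> mC; apply/esym/product_measure_unique => // A B mA mB.
  rewrite -[X in (_ = _ * X)%E]/(mu B) -Xmu// /distribution /pushforward/=.
  (* A cylinder over the single index [i] is an event on [X i] alone. *)
  have := @fold_rv_independent s [set i]%SET (fun=> B) A us _ _ mA.
  rewrite big_set1 => <-//.
  - congr (P (_ `&` _)); apply/seteqP; split => [t Bt j /=|t].
      by rewrite inE => /eqP ->.
    by apply; rewrite /= inE.
  - by move=> j js; rewrite inE; apply: contraNneq is_ => <-.
transitivity (\int[distribution P W']_u (h \o g i) u)%E.
  by rewrite ge0_integral_pushforward// => y _; exact: h0.
transitivity (\int[distribution P F' \x mu]_u (h \o g i) u)%E.
  by apply: eq_measure_integral => C mC _; exact: law.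
rewrite fubini_tonelli1//; last by move=> u; exact: h0.
rewrite ge0_integral_pushforward//.
- by apply: measurable_fun_fubini_tonelli_F => // u; exact: h0.
- by move=> y _; apply: integral_ge0 => x _; exact: h0.
Qed.

End independent_fold.

(** * Laplace transforms of the quadratic forms *)

(* [normal_prob] is a measure on [measurableTypeR R], whose display differs from
   that of the canonical measurable structure on [R]. *)
Local Notation plane R := (measurableTypeR R * measurableTypeR R)%type.
Local Notation state R := (plane R * measurableTypeR R)%type.

Definition sqnorm (R : realType) (v : plane R) : R := v.1 ^+ 2 + v.2 ^+ 2.

(* A state (z, w) holds the partial sums z = sum_i conj(h_i) v_i, as a pair of
   real and imaginary parts, and w = sum_i |h_i|^2. *)
Definition add_term (R : realType) (v x : plane R) (y : state R) : state R :=
  (y.1.1 + (x.1 * v.1 + x.2 * v.2), y.1.2 + (x.1 * v.2 - x.2 * v.1),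
   y.2 + (x.1 ^+ 2 + x.2 ^+ 2)).

(** The mean of this weight is the joint Laplace transform of [W] and [|Z|^2]. For fixed [t] the
    family is stable, up to a factor, under integrating out a coordinate. *)
Definition gauss_weight (R : realType) (t q : R) (y : state R) : R :=
  expR (- (t * y.2 + q * (y.1.1 ^+ 2 + y.1.2 ^+ 2))).

Lemma measurable_add_term (R : realType) (v : plane R) :
  measurable_fun [set: state R * plane R]
    (fun u => add_term v u.2 u.1).
Proof.
have mf1 : measurable_fun [set: state R * plane R] (fun u => u.1.1.1).
  exact: measurableT_comp measurable_fst
    (measurableT_comp measurable_fst measurable_fst).
have mf2 : measurable_fun [set: state R * plane R] (fun u => u.1.1.2).
  exact: measurableT_comp measurable_snd
    (measurableT_comp measurable_fst measurable_fst).
have mf3 : measurable_fun [set: state R * plane R] (fun u => u.1.2).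
  exact: measurableT_comp measurable_snd measurable_fst.
have ms1 : measurable_fun [set: state R * plane R] (fun u => u.2.1).
  exact: measurableT_comp measurable_fst measurable_snd.
have ms2 : measurable_fun [set: state R * plane R] (fun u => u.2.2).
  exact: measurableT_comp measurable_snd measurable_snd.
apply: measurable_fun_pair; first apply: measurable_fun_pair.
- apply: measurable_funD => //.
  by apply: measurable_funD; apply: measurable_funM.
- apply: measurable_funD => //.
  by apply: measurable_funB; apply: measurable_funM.
- apply: measurable_funD => //.
  by apply: measurable_funD; apply: measurable_funX.
Qed.

Lemma measurable_gauss_weight (R : realType) (t q : R) :
  measurable_fun [set: state R] (gauss_weight t q).
Proof.
have mf1 : measurable_fun [set: state R] (fun y => y.1.1).
  exact: measurableT_comp measurable_fst measurable_fst.
have mf2 : measurable_fun [set: state R] (fun y => y.1.2).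
  exact: measurableT_comp measurable_snd measurable_fst.
apply: measurableT_comp => //; apply: measurableT_comp => //.
apply: measurable_funD; apply: measurable_funM => //.
by apply: measurable_funD; apply: measurable_funX.
Qed.

(** One factor of [circular_gaussian_law], bundled as a probability so that the product of two
    copies is again one. *)
Definition gaussian_component (R : realType) (alpha : R) :
    probability (measurableTypeR R) R :=
  normal_prob 0 (Num.sqrt (alpha / 2)).

(** In [|z + conj(x) v|^2] the products of the real and imaginary parts of [x] cancel, so the
    integral splits into two one-dimensional Gaussian integrals with the same quadratic coefficient
    [tau]. *)
Lemma integral_circular_gaussian_add_term (R : realType) (alpha t q : R)
    (v : plane R) (y : state R) :
  let A := 1 + alpha * t in
  let D := A + alpha * q * (v.1 ^+ 2 + v.2 ^+ 2) in
  0 < alpha -> 0 <= t -> 0 <= q ->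
  (\int[gaussian_component alpha \x gaussian_component alpha]_x
     (gauss_weight t q (add_term v x y))%:E =
   (D^-1 * gauss_weight t (q * A / D) y)%:E)%E.
Proof.
move=> A D a0 t0 q0.
set s := Num.sqrt (alpha / 2).
have s0 : 0 < s by rewrite sqrtr_gt0 divr_gt0.
have s2 : s ^+ 2 = alpha / 2 by rewrite sqr_sqrtr// ltW// divr_gt0.
set tau := t + q * (v.1 ^+ 2 + v.2 ^+ 2).
have DE : 1 + 2 * tau * s ^+ 2 = D by rewrite s2 /D /A /tau; field.
have D0 : 0 < D.
  have tau0 : 0 <= tau by rewrite addr_ge0// mulr_ge0// addr_ge0 ?sqr_ge0.
  by rewrite -DE ltr_wpDr// mulr_ge0 ?sqr_ge0// mulr_ge0.
set c1 := 2 * q * (y.1.1 * v.1 + y.1.2 * v.2).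
set c2 := 2 * q * (y.1.1 * v.2 - y.1.2 * v.1).
pose e c x := expR (- (tau * x ^+ 2 + c * x)).
have me c : measurable_fun [set: R] (e c).
  apply: measurableT_comp => //; apply: measurableT_comp => //.
  by apply: measurable_funD => //; apply: measurable_funM.
have gE x : gauss_weight t q (add_term v x y) =
    gauss_weight t q y * e c1 x.1 * e c2 x.2.
  rewrite /gauss_weight /e -!expRD; congr expR.
  by rewrite /add_term /= /tau /c1 /c2; ring.
rewrite fubini_tonelli1//=; last 2 first.
- apply/measurable_EFinP/(measurableT_comp (measurable_gauss_weight t q)).
  exact: measurable_fun_pair2 (measurable_add_term v).
- by move=> x; rewrite lee_fin expR_ge0.
transitivity (\int[normal_prob 0 s]_x
   (((gauss_weight t q y)%:E * \int[normal_prob 0 s]_z (e c2 z)%:E) *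
      (e c1 x)%:E))%E.
  apply: eq_integral => x _; rewrite /fubini_F/=.
  transitivity (\int[normal_prob 0 s]_z
    (((gauss_weight t q y) * e c1 x)%:E * (e c2 z)%:E))%E.
    by apply: eq_integral => z _; rewrite gE -EFinM.
  rewrite ge0_integralZl//.
  - by rewrite EFinM muleAC.
  - by apply/measurable_EFinP; exact: me.
  - by move=> z _; rewrite lee_fin expR_ge0.
  - by rewrite lee_fin mulr_ge0 ?expR_ge0.
rewrite integral_normal_prob_expR ?DE// ge0_integralZl//; last 3 first.
- by apply/measurable_EFinP; exact: me.
- by move=> z _; rewrite lee_fin expR_ge0.
- by rewrite -EFinM lee_fin !mulr_ge0 ?invr_ge0 ?expR_ge0.
rewrite integral_normal_prob_expR ?DE// -!EFinM; congr EFin.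
transitivity ((Num.sqrt D ^+ 2)^-1 * (gauss_weight t q y *
  expR (c2 ^+ 2 * s ^+ 2 / (2 * D)) * expR (c1 ^+ 2 * s ^+ 2 / (2 * D)))).
  by rewrite -exprVn; ring.
(* Since [c1^2 + c2^2 = 4 q^2 |z|^2 |v|^2], the two exponents together change the coefficient [q] of
   [|z|^2] into [q A / D]. *)
rewrite sqr_sqrtr 1?ltW// /gauss_weight -!expRD; congr (_ * expR _).
rewrite s2 /c1 /c2 /D /A; field.
by rewrite /= -/A -/D gt_eqF.
Qed.

(** Induction on [s] for all [q] at once, as each step changes [q]. Writing [A / A ^+ size s]
    instead of a power with a predecessor keeps the formula right for the empty list, where it
    equals 1. *)
Lemma integral_gauss_weight_fold (R : realType) d (T : measurableType d)
    (P : probability T R) (I : finType) (X : I -> T -> plane R)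
    (v : I -> plane R) (alpha t q : R) (s : seq I) :
  let A := 1 + alpha * t in
  (forall i, measurable_fun setT (X i)) ->
  (forall i B, measurable B ->
     P (X i @^-1` B) = circular_gaussian_law alpha B) ->
  mutually_independent P X ->
  uniq s -> 0 < alpha -> 0 <= t -> 0 <= q ->
  (\int[P]_w (gauss_weight t q
     (fold_rv X (fun i u => add_term (v i) u.2 u.1) (0, 0, 0) s w))%:E =
   (A / (A ^+ size s * (A + alpha * q * \sum_(i <- s) sqnorm (v i))))%:E)%E.
Proof.
move=> A mX Xlaw indX us a0 t0.
have A0 : 0 < A by rewrite ltr_wpDr// mulr_ge0// ltW.
have Sge0 r : 0 <= \sum_(i <- r) sqnorm (v i).
  by apply: sumr_ge0 => i _; rewrite addr_ge0// sqr_ge0.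
elim: s us q => [_|i s IHs us] q q0.
  under eq_integral do
    rewrite /fold_rv /gauss_weight /= expr0n/= addr0 !mulr0 addr0 oppr0 expR0.
  rewrite integral_cst// mul1e [LHS](probability_setT P).
  rewrite big_nil expr0 mul1r mulr0 addr0.
  by rewrite divff ?gt_eqF.
pose N := gaussian_component alpha.
rewrite (@integral_fold_rv_cons _ _ _ _ _ _ _ _ _ _ _ _ mX _ indX i s
  (fun y => (gauss_weight t q y)%:E) (N \x N)%E)//; last 4 first.
- by move=> j; exact: measurable_add_term.
- by apply/measurable_EFinP; exact: measurable_gauss_weight.
- by move=> y; rewrite lee_fin expR_ge0.
- exact: Xlaw.
set n := sqnorm (v i); set D := A + alpha * q * n.
have D0 : 0 < D.
  rewrite ltr_wpDr// mulr_ge0// ?mulr_ge0// ?(ltW a0)//.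
  by rewrite addr_ge0// sqr_ge0.
under eq_integral => w _.
  rewrite (@integral_circular_gaussian_add_term R alpha t q)// EFinM.
  over.
rewrite ge0_integralZl//; last 3 first.
- apply/measurable_EFinP; apply: measurableT_comp.
    exact: measurable_gauss_weight.
  apply: measurable_fold_rv => // j; exact: measurable_add_term.
- by move=> y; rewrite lee_fin expR_ge0.
- by rewrite lee_fin invr_ge0 ltW.
move: us => /= /andP[_ us].
rewrite -/A -/n -/D IHs//; last by rewrite !mulr_ge0// ?invr_ge0// ltW.
rewrite -EFinM big_cons exprS; congr EFin; rewrite -/n.
set S := \sum_(j <- s) _.
have S0 : 0 <= S := Sge0 s.
have An0 : A ^+ size s != 0 by rewrite expf_neq0// gt_eqF.
have DS : D + alpha * q * S != 0.
  by rewrite gt_eqF// ltr_wpDr// mulr_ge0// mulr_ge0// ltW.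
(* With the updated coefficient, the denominator carries a factor [1 / D] that cancels the [D^-1]
   from the coordinate just removed. *)
have -> : A + alpha * (q * A / D) * S = A * (D + alpha * q * S) / D.
  by field; rewrite gt_eqF.
have -> : A + alpha * q * (n + S) = D + alpha * q * S by rewrite /D; ring.
move: (gt_eqF D0) (gt_eqF A0) => /negbT D1 /negbT A1.
by field; rewrite D1 A1 An0 DS.
Qed.

(** * Elementary integrals and Frullani's formula *)

Lemma integral_itv_is_derive (R : realType) (f F : R -> R) (a b : R) :
  a < b ->
  (forall x, a <= x <= b -> {for x, continuous f}) ->
  (forall x, a <= x <= b -> is_derive x 1 F (f x)) ->
  (\int[lebesgue_measure]_(x in `[a, b]) (f x)%:E = (F b - F a)%:E)%E.
Proof.
move=> ab cf dF.
have cF x : a <= x <= b -> {for x, continuous F}.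
  move=> /dF dFx; apply/differentiable_continuous/derivable1_diffP.
  exact: ex_derive.
rewrite EFinB; apply: continuous_FTC2 => //.
- by apply: continuous_in_subspaceT => x; rewrite inE/= in_itv/=; exact: cf.
- split.
  + move=> x; rewrite in_itv/= => /andP[ax xb].
    by apply: ex_derive; apply: dF; rewrite !ltW.
  + by apply/cvg_at_right_filter; apply: cF; rewrite lexx ltW.
  + by apply/cvg_at_left_filter; apply: cF; rewrite lexx ltW.
- move=> x; rewrite in_itv/= => /andP[ax xb]; rewrite derive1E.
  by apply: derive_val; apply: dF; rewrite !ltW.
Qed.

Lemma ge0_integral_itvy_is_derive (R : realType) (f F : R -> R) (a l : R) :
  (forall x, a <= x -> 0 <= f x) ->
  (forall x, a <= x -> {for x, continuous f}) ->
  (forall x, a <= x -> is_derive x 1 F (f x)) ->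
  F x @[x --> +oo] --> l ->
  (\int[lebesgue_measure]_(x in `]a, +oo[) (f x)%:E = (l - F a)%:E)%E.
Proof.
move=> f0 cf dF Fl.
have cF x : a <= x -> {for x, continuous F}.
  move=> /dF dFx; apply/differentiable_continuous/derivable1_diffP.
  exact: ex_derive.
rewrite EFinB integral_itv_obnd_cbnd; last first.
  apply/measurable_EFinP; apply: open_continuous_measurable_fun => //.
  by move=> x; rewrite inE/= in_itv/= andbT => /ltW; exact: cf.
apply: ge0_continuous_FTC2y => //.
- apply: continuous_in_subspaceT => x; rewrite inE/= in_itv/= andbT.
  exact: cf.
- by move=> x ax; apply: ex_derive; apply: dF; rewrite ltW.
- by apply/cvg_at_right_filter; apply: cF.
- move=> x; rewrite in_itv/= andbT => ax; rewrite derive1E.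
  by apply: derive_val; apply: dF; rewrite ltW.
Qed.

(** The inner integral for Frullani's formula: as [r] runs over [0, 1], the rate moves from [w] to
    [w + u]. Keeping the factor [u] avoids a division, so [u = 0] is covered. *)
Lemma integral_expR_itv01 (R : realType) (t w u : R) : 0 < t ->
  (\int[lebesgue_measure]_(r in `[0%R, 1%R])
     (u * expR (- (t * (w + r * u))))%:E =
   (expR (- (t * w)) * (1 - expR (- (t * u))) / t)%:E)%E.
Proof.
move=> t0.
pose F (r : R) := - expR (- (t * (w + r * u))) / t.
have dF (r : R) : is_derive r 1 F (u * expR (- (t * (w + r * u)))).
  apply: is_derive_eq; rewrite /GRing.scale/=; field.
  by rewrite gt_eqF.
rewrite (@integral_itv_is_derive _ _ F)//.
- congr EFin; rewrite /F !mul1r !mul0r addr0 mulrDr opprD expRD.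
  by field; rewrite gt_eqF.
- move=> x _; apply: differentiable_continuous; apply/derivable1_diffP.
  exact: ex_derive.
Qed.

Lemma integral_inv_itv01 (R : realType) (w u : R) : 0 < w -> 0 <= u ->
  (\int[lebesgue_measure]_(r in `[0%R, 1%R]) (u / (w + r * u))%:E =
   (ln (1 + u / w))%:E)%E.
Proof.
move=> w0 u0.
have wru0 (r : R) : 0 <= r <= 1 -> 0 < w + r * u.
  by move=> /andP[r0 _]; rewrite ltr_wpDr// mulr_ge0.
have dF (x : R) : 0 <= x <= 1 ->
    is_derive x 1 (fun r => ln (w + r * u)) (u / (w + x * u)).
  move=> /wru0 x0; have dln := is_derive1_ln x0.
  by apply: is_derive_eq; rewrite /GRing.scale/=; field; rewrite gt_eqF.
rewrite (integral_itv_is_derive _ _ dF)//.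
- congr EFin; rewrite mul1r mul0r addr0 -ln_div ?posrE ?ltr_wpDr//.
  by congr ln; field; rewrite gt_eqF.
- move=> x /wru0 x0; apply: continuousM; first exact: cvg_cst.
  apply: continuousV; first by rewrite gt_eqF.
  apply: continuousD; first exact: cvg_cst.
  by apply: continuousM; [exact: cvg_id|exact: cvg_cst].
Qed.

Lemma integral_expR_itv0y (R : realType) (c : R) : 0 < c ->
  (\int[lebesgue_measure]_(t in `]0%R, +oo[) (expR (- (t * c)))%:E = c^-1%:E)%E.
Proof.
move=> c0; pose F (t : R) := - expR (- (t * c)) / c.
have dF (t : R) : 0 <= t -> is_derive t 1 F (expR (- (t * c))).
  move=> _; apply: is_derive_eq; rewrite /GRing.scale/=.
  by field; rewrite gt_eqF.
rewrite (ge0_integral_itvy_is_derive _ _ dF (l := 0)).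
- by rewrite /F mul0r oppr0 expR0; congr EFin; field; rewrite gt_eqF.
- by move=> x _; exact: expR_ge0.
- move=> x _; apply: differentiable_continuous; apply/derivable1_diffP.
  exact: ex_derive.
- rewrite -[X in _ --> X](mul0r c^-1) -[X in X * _]oppr0.
  apply: cvgM; last exact: cvg_cst.
  apply: cvgN; apply: (@cvg_comp _ _ _ (fun t => t * c) (fun t => expR (- t))).
    by apply: gt0_cvgMly => //; exact: cvg_id.
  exact: cvgr_expR.
Qed.

Lemma integral_indicM (R : realType) (A : set (measurableTypeR R))
    (h : R -> R) :
  (\int[lebesgue_measure]_x (\1_A x * h x)%:E =
   \int[lebesgue_measure]_(x in A) (h x)%:E)%E.
Proof.
rewrite [RHS]integral_mkcond; apply: eq_integral => x _.
by rewrite patchE indicE; case: ifP => _; rewrite ?mul1r ?mul0r.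
Qed.

(** Both sides are iterated integrals of [u exp(- t (w + r u))] over [r] in [0, 1] and [t > 0];
    Tonelli exchanges the order. *)
Lemma frullani_integral (R : realType) (w u : R) : 0 < w -> 0 <= u ->
  (\int[lebesgue_measure]_(t in `]0%R, +oo[)
     (expR (- (t * w)) * (1 - expR (- (t * u))) / t)%:E =
   (ln (1 + u / w))%:E)%E.
Proof.
move=> w0 u0; set D := `]0, +oo[%classic.
pose C : set R := `[0%R, 1%R]%classic.
pose k (r t : R) := u * expR (- (t * (w + r * u))).
(* Indicators carry the two domains, so that Tonelli is applied on the whole plane. *)
pose f (z : measurableTypeR R * measurableTypeR R) :=
  (\1_C z.1 * (\1_D z.2 * k z.1 z.2))%:E.
have mind (A : set (measurableTypeR R)) : measurable A ->
    measurable_fun [set: measurableTypeR R] (\1_A : _ -> R).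
  by move=> mA; exact: measurable_indic.
have mf : measurable_fun setT f.
  apply/measurable_EFinP; apply: measurable_funM.
    exact: measurableT_comp (mind C (measurable_itv _)) measurable_fst.
  apply: measurable_funM.
    exact: measurableT_comp (mind D (measurable_itv _)) measurable_snd.
  apply: measurable_funM => //; apply: measurableT_comp => //.
  apply: measurableT_comp => //; apply: measurable_funM => //.
  by apply: measurable_funD => //; apply: measurable_funM.
have f0 z : (0 <= f z)%E.
  by rewrite lee_fin !mulr_ge0 ?expR_ge0.
have := @fubini_tonelli _ _ _ _ _ lebesgue_measure lebesgue_measure f mf f0.
rewrite /fubini_F /fubini_G => FG.
transitivity (\int[lebesgue_measure]_y \int[lebesgue_measure]_x f (x, y))%E.
  rewrite integral_mkcond; apply: eq_integral => t _; rewrite patchE.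
  rewrite [RHS](integral_indicM C (fun x => \1_D t * k x t)).
  case: ifPn => [tD|tD].
    have t0 : 0 < t by move: tD; rewrite inE /D/= in_itv/= andbT.
    rewrite -(integral_expR_itv01 w u t0) -/C; apply: eq_integral => r _.
    by rewrite indicE tD mul1r.
  by apply/esym/integral0_eq => r _; rewrite indicE (negbTE tD) mul0r.
rewrite -FG -(integral_inv_itv01 w0 u0) -/C [RHS]integral_mkcond.
apply: eq_integral => r _; rewrite patchE.
under eq_integral do rewrite /f/= mulrCA.
rewrite (integral_indicM D (fun t => \1_C r * k r t)).
case: ifPn => [rC|rC]; last first.
  by apply/integral0_eq => t _; rewrite indicE (negbTE rC) mul0r.
have wru0 : 0 < w + r * u.
  move: (rC); rewrite inE /C/= in_itv/= => /andP[r0 _].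
  by rewrite ltr_wpDr ?mulr_ge0.
transitivity (\int[lebesgue_measure]_(t in D)
    (u%:E * (expR (- (t * (w + r * u))))%:E))%E.
  by apply: eq_integral => t _; rewrite indicE rC mul1r EFinM.
rewrite ge0_integralZl.
- by rewrite integral_expR_itv0y.
- exact: measurable_itv.
- apply/measurable_EFinP; apply: measurable_funTS.
  exact: measurableT_comp (@measurable_expR R)
    (measurableT_comp (@oppr_measurable R _) (@mulrr_measurable R _ _)).
- by move=> t _; rewrite lee_fin expR_ge0.
- by rewrite lee_fin.
Qed.

(** * The remaining integral over [t] and its recurrence *)

(* E ln (1 + kappa B) for B ~ Beta(1, n), with B = 1 if n = 0. *)
Fixpoint log_beta_mean (R : realType) (kappa : R) (n : nat) : R :=
  if n is m.+1 then log_beta_mean kappa m * (1 + kappa^-1) - m.+1%:R^-1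
  else ln (1 + kappa).

(** With [A = 1 + alpha t], this is the difference of [1 / A^(n+1)] and
    [A / (A^(n+1) (A + alpha t kappa))], divided by [t]: the two Laplace transforms for
    [M = n + 1]. *)
Definition log_beta_integrand (R : realType) (alpha kappa : R) (n : nat)
    (t : R) : R :=
  alpha * kappa / ((1 + alpha * t) ^+ n.+1 * (1 + alpha * (1 + kappa) * t)).

Section log_beta.
Context (R : realType) (alpha kappa : R).
Hypotheses (alpha0 : 0 < alpha) (kappa0 : 0 < kappa).

Let A0 (t : R) : 0 <= t -> 0 < 1 + alpha * t.
Proof. by move=> t0; rewrite ltr_wpDr// mulr_ge0// ltW. Qed.

Let B0 (t : R) : 0 <= t -> 0 < 1 + alpha * (1 + kappa) * t.
Proof. by move=> t0; rewrite ltr_wpDr// !mulr_ge0// ?addr_ge0// ltW. Qed.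

Let continuous_affine (c t : R) : {for t, continuous (fun t : R => 1 + c * t)}.
Proof.
by apply: differentiable_continuous; apply/derivable1_diffP; exact: ex_derive.
Qed.

Let continuous_affineX (c t : R) n :
  {for t, continuous (fun t : R => (1 + c * t) ^+ n)}.
Proof.
apply: (@continuous_comp _ _ _ (fun t : R => 1 + c * t) (fun y : R => y ^+ n)).
  exact: continuous_affine.
exact: exprn_continuous.
Qed.

Let continuous_log_beta_integrand n (t : R) : 0 <= t ->
  {for t, continuous (log_beta_integrand alpha kappa n)}.
Proof.
move=> t0; apply: continuousM; first exact: cvg_cst.
apply: continuousV; first by rewrite mulf_neq0// ?expf_neq0// gt_eqF ?A0 ?B0.
by apply: continuousM; [exact: continuous_affineX|exact: continuous_affine].
Qed.

Let continuous_inv_expr n (t : R) : 0 <= t ->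
  {for t, continuous (fun t => alpha / (1 + alpha * t) ^+ n)}.
Proof.
move=> t0; apply: continuousM; first exact: cvg_cst.
apply: continuousV; first by rewrite expf_neq0// gt_eqF ?A0.
exact: continuous_affineX.
Qed.

Let measurable_itv0y (f : R -> R) :
  (forall t, 0 <= t -> {for t, continuous f}) ->
  measurable_fun (`]0%R, +oo[%classic : set (measurableTypeR R)) (EFin \o f).
Proof.
move=> cf; apply/measurable_EFinP; apply: open_continuous_measurable_fun => //.
by move=> x; rewrite inE/= in_itv/= andbT => /ltW; exact: cf.
Qed.

Lemma log_beta_integrand_ge0 n (t : R) : 0 <= t ->
  0 <= log_beta_integrand alpha kappa n t.
Proof.
move=> t0; rewrite /log_beta_integrand divr_ge0 ?mulr_ge0 ?exprn_ge0//;
by rewrite ltW// ?A0 ?B0.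
Qed.

Let cvg_affine_pinfty (c : R) : 0 < c -> 1 + c * t @[t --> +oo] --> +oo.
Proof.
move=> c0; apply/cvgryPge => r; near=> t.
by rewrite -lerBlDl -ler_pdivrMl//; near: t.
Unshelve. all: by end_near. Qed.

Let cvgV_affine : (1 + alpha * t)^-1 @[t --> +oo] --> (0 : R).
Proof.
apply/(@gtr0_cvgV0 _ _ _ _ (fun t => 1 + alpha * t)); last first.
  exact: cvg_affine_pinfty.
near=> t; apply: A0; near: t; exact: nbhs_pinfty_ge.
Unshelve. all: by end_near. Qed.

(** Partial fractions give a difference of two logarithms as antiderivative. *)
Lemma integral_log_beta_integrand0 :
  (\int[lebesgue_measure]_(t in `]0%R, +oo[)
     (log_beta_integrand alpha kappa 0 t)%:E = (ln (1 + kappa))%:E)%E.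
Proof.
pose F (t : R) := ln (1 + alpha * (1 + kappa) * t) - ln (1 + alpha * t).
have dF (t : R) : 0 <= t ->
    is_derive t 1 F (log_beta_integrand alpha kappa 0 t).
  move=> t0; have A1 := lt0r_neq0 (A0 t0); have B1 := lt0r_neq0 (B0 t0).
  have dA : is_derive t 1 (fun t => ln (1 + alpha * t))
      (alpha / (1 + alpha * t)).
    have dln := is_derive1_ln (A0 t0).
    by apply: is_derive_eq; rewrite /GRing.scale/=; field.
  have dB : is_derive t 1 (fun t => ln (1 + alpha * (1 + kappa) * t))
      (alpha * (1 + kappa) / (1 + alpha * (1 + kappa) * t)).
    have dln := is_derive1_ln (B0 t0).
    by apply: is_derive_eq; rewrite /GRing.scale/=; field.
  by apply: is_derive_eq; rewrite /log_beta_integrand; field; rewrite A1 B1.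
rewrite (ge0_integral_itvy_is_derive _ _ dF (l := ln (1 + kappa))).
- by rewrite /F !mulr0 !addr0 ln1 !subr0.
- by move=> t; exact: log_beta_integrand_ge0.
- exact: continuous_log_beta_integrand.
(* The quotient of the two affine functions is [1 + kappa - kappa / (1 + alpha t)]. *)
- apply: (@cvg_trans _
    (ln (1 + kappa - kappa * (1 + alpha * t)^-1) @[t --> +oo])).
    apply: near_eq_cvg; near=> t.
    have t0 : 0 <= t by near: t; exact: nbhs_pinfty_ge.
    rewrite /F -ln_div ?posrE ?A0 ?B0//; congr ln.
    by field; rewrite lt0r_neq0// A0.
  apply: (@continuous_cvg _ _ _ _ _ _ (@ln R)).
    by apply: continuous_ln; rewrite addr_gt0.
  rewrite -[X in _ --> X]subr0; apply: cvgB; first exact: cvg_cst.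
  rewrite -[X in _ --> X](mulr0 kappa).
  by apply: cvgM; [exact: cvg_cst|exact: cvgV_affine].
Unshelve. all: by end_near. Qed.

Lemma integral_inv_expr n :
  (\int[lebesgue_measure]_(t in `]0%R, +oo[)
     (alpha / (1 + alpha * t) ^+ n.+2)%:E = (n.+1%:R^-1)%:E)%E.
Proof.
pose F (t : R) := - n.+1%:R^-1 / (1 + alpha * t) ^+ n.+1.
have dF (t : R) : 0 <= t -> is_derive t 1 F (alpha / (1 + alpha * t) ^+ n.+2).
  move=> t0; have A1 := lt0r_neq0 (A0 t0).
  have An : (1 + alpha * t) ^+ n.+1 != 0 by rewrite expf_neq0.
  have dA : is_derive t 1 (fun t => 1 + alpha * t) alpha.
    by apply: is_derive_eq; rewrite /GRing.scale/=; ring.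
  have dX : is_derive t 1 (fun t => (1 + alpha * t) ^+ n.+1)
      ((n.+1%:R * (1 + alpha * t) ^+ n) *: alpha).
    by have := is_deriveX n.+1 dA; rewrite exprfctE.
  have dV := is_deriveV (f := fun t => (1 + alpha * t) ^+ n.+1) An dX.
  have dZ := is_deriveZ (- n.+1%:R^-1) dV.
  apply: is_derive_eq dZ _; rewrite /GRing.scale/= !exprS.
  have An' : (1 + alpha * t) ^+ n != 0 by rewrite expf_neq0.
  have : n.+1%:R != 0 :> R by rewrite pnatr_eq0.
  by move: (n.+1%:R : R) => c c0; field; rewrite A1 An' c0.
rewrite (ge0_integral_itvy_is_derive _ _ dF (l := 0)).
- by rewrite /F mulr0 addr0 expr1n divr1 sub0r opprK.
- by move=> t t0; rewrite divr_ge0 ?exprn_ge0// ltW ?A0.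
- exact: continuous_inv_expr.
- rewrite -[X in _ --> X](mulr0 (- n.+1%:R^-1)).
  apply: cvgM; first exact: cvg_cst.
  rewrite -[X in _ --> X](expr0n R n.+1); under eq_fun do rewrite -exprVn.
  apply: (@continuous_cvg _ _ _ _ _ _ (fun y : R => y ^+ n.+1)).
    exact: exprn_continuous.
  exact: cvgV_affine.
Qed.

(** With [A = 1 + alpha t] and [B = 1 + alpha (1 + kappa) t], the identity
    [kappa + B = (1 + kappa) A] links the integrands of orders [n] and [n + 1]. *)
Lemma integral_log_beta_integrand n :
  (\int[lebesgue_measure]_(t in `]0%R, +oo[)
     (log_beta_integrand alpha kappa n t)%:E = (log_beta_mean kappa n)%:E)%E.
Proof.
elim: n => [|n IHn]; first exact: integral_log_beta_integrand0.
(* The recurrence is stated as a sum of nonnegative terms, so it can be integrated without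
   integrability conditions; the subtraction comes last, between known values. *)
have : (\int[lebesgue_measure]_(t in `]0%R, +oo[)
    ((log_beta_integrand alpha kappa n.+1 t)%:E
     + (alpha / (1 + alpha * t) ^+ n.+2)%:E)
  = \int[lebesgue_measure]_(t in `]0%R, +oo[)
    ((1 + kappa^-1)%:E * (log_beta_integrand alpha kappa n t)%:E))%E.
  apply: eq_integral => t; rewrite inE/= in_itv/= andbT => /ltW t0.
  rewrite -EFinD -EFinM; congr EFin; rewrite /log_beta_integrand.
  have A1 := lt0r_neq0 (A0 t0); have B1 := lt0r_neq0 (B0 t0).
  have An : (1 + alpha * t) ^+ n != 0 by rewrite expf_neq0.
  by rewrite !exprS; field; rewrite A1 B1 An lt0r_neq0.
rewrite ge0_integralD//; last 4 first.
- move=> t; rewrite /= in_itv/= andbT => /ltW t0.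
  by rewrite lee_fin log_beta_integrand_ge0.
- by apply: measurable_itv0y => t; exact: continuous_log_beta_integrand.
- move=> t; rewrite /= in_itv/= andbT => /ltW t0.
  by rewrite lee_fin divr_ge0 ?exprn_ge0// ltW ?A0.
- by apply: measurable_itv0y => t; exact: continuous_inv_expr.
rewrite ge0_integralZl//; last 3 first.
- by apply: measurable_itv0y => t; exact: continuous_log_beta_integrand.
- move=> t; rewrite /= in_itv/= andbT => /ltW t0.
  by rewrite lee_fin log_beta_integrand_ge0.
- by rewrite lee_fin addr_ge0// invr_ge0 ltW.
rewrite IHn integral_inv_expr -EFinM mulrC => E.
by rewrite EFinB -E addeK.
Qed.

End log_beta.

(** * Asymptotics for large [kappa] *)

(** From [ln k = 2 ln (sqrt k) <= 2 sqrt k], the quotient is at most [2 / sqrt k]. *)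
Lemma ln_div_cvg0 (R : realType) : ln k / k @[k --> +oo] --> (0 : R).
Proof.
apply/cvgrPdist_le => e e0; near=> k.
have k0 : 0 < k by near: k; exact: nbhs_pinfty_gt.
have k1 : 1 <= k by near: k; exact: nbhs_pinfty_ge.
have sk0 : 0 < Num.sqrt k by rewrite sqrtr_gt0.
have kE : Num.sqrt k ^+ 2 = k by rewrite sqr_sqrtr// ltW.
rewrite sub0r normrN ger0_norm ?divr_ge0 ?ln_ge0// ?(ltW k0)//.
have lnk : ln k <= 2 * Num.sqrt k.
  have -> : ln k = 2 * ln (Num.sqrt k) by rewrite -[in LHS]kE lnXn// mulr_natl.
  by rewrite ler_pM2l// ltW// ln_sublinear.
rewrite ler_pdivrMr//; apply: le_trans lnk _.
rewrite -{2}kE expr2 mulrA ler_pM2r// -ler_pdivrMl// mulrC.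
have -> : 2 / e = Num.sqrt ((2 / e) ^+ 2).
  by rewrite sqrtr_sqr ger0_norm// divr_ge0// ltW.
by rewrite ler_wsqrtr//; near: k; exact: nbhs_pinfty_ge.
Unshelve. all: by end_near. Qed.

Lemma log_beta_mean_cvg (R : realType) n :
  log_beta_mean k n - ln k @[k --> +oo] -->
    - \sum_(1 <= i < n.+1) (i%:R : R)^-1.
Proof.
have kV : k^-1 @[k --> +oo] --> (0 : R).
  apply/(@gtr0_cvgV0 _ _ _ _ id) => //.
  by near=> k; near: k; exact: nbhs_pinfty_gt.
elim: n => [|n IHn].
  rewrite big_geq// oppr0.
  have ln1V : ln (1 + k^-1) @[k --> +oo] --> (0 : R).
    rewrite -[X in _ --> X](ln1 R).
    apply: (@continuous_cvg _ _ _ _ _ _ (@ln R)); first exact: continuous_ln.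
    by rewrite -[X in _ --> X]addr0; apply: cvgD => //; exact: cvg_cst.
  apply: cvg_trans ln1V; apply: near_eq_cvg; near=> k.
  have k0 : 0 < k by near: k; exact: nbhs_pinfty_gt.
  rewrite /= -ln_div ?posrE ?addr_gt0//; congr ln.
  by field; rewrite gt_eqF.
set L := - _ in IHn.
have -> : - \sum_(1 <= i < n.+2) (i%:R : R)^-1 = L + (L * 0 + 0) - n.+1%:R^-1.
  by rewrite big_nat_recr//= opprD mulr0 !addr0.
(* [log_beta_mean k n] itself diverges, so its quotient by [k] is split into
   [(log_beta_mean k n - ln k) / k] and [ln k / k], which both vanish in the limit. *)
apply: (@cvg_trans _ ((log_beta_mean k n - ln k)
    + ((log_beta_mean k n - ln k) * k^-1 + ln k / k) - n.+1%:R^-1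
    @[k --> +oo])).
  by apply: near_eq_cvg; near=> k; rewrite /=; ring.
apply: cvgB; last exact: cvg_cst.
apply: cvgD => //; apply: cvgD; last exact: ln_div_cvg0.
exact: cvgM.
Unshelve. all: by end_near. Qed.

(** * The mean of the logarithm of the ratio *)

Lemma fold_add_termE (R : realType) d (T : measurableType d) (I : finType)
    (X : I -> T -> plane R) (v : I -> plane R) (s : seq I) (w : T) :
  fold_rv X (fun i u => add_term (v i) u.2 u.1) (0, 0, 0) s w =
  (\sum_(i <- s) ((X i w).1 * (v i).1 + (X i w).2 * (v i).2),
   \sum_(i <- s) ((X i w).1 * (v i).2 - (X i w).2 * (v i).1),
   \sum_(i <- s) sqnorm (X i w)).
Proof.
elim: s => [|i s IHs]; first by rewrite !big_nil.
set F := fold_rv _ _ _ in IHs *.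
rewrite -[LHS]/(add_term (v i) (X i w) (F s w)) IHs !big_cons /add_term /=.
by congr (_, _, _); rewrite addrC.
Qed.

Section mean_log_ratio.
Context (R : realType) d (T : measurableType d) (P : probability T R)
  (I : finType) (X : I -> T -> plane R) (v : I -> plane R) (alpha : R).
Hypotheses (mX : forall i, measurable_fun setT (X i))
  (Xlaw : forall i B, measurable B ->
     P (X i @^-1` B) = circular_gaussian_law alpha B)
  (indX : mutually_independent P X) (alpha0 : 0 < alpha).

Let Y := fold_rv X (fun i u => add_term (v i) u.2 u.1) (0, 0, 0)
  (enum I).
Let W w := (Y w).2.
Let U w := sqnorm (Y w).1.
Let S := \sum_i sqnorm (v i).

Let U0 w : 0 <= U w. Proof. by rewrite addr_ge0 ?sqr_ge0. Qed.

Let W0 w : 0 <= W w.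
Proof.
rewrite /W /Y fold_add_termE/=.
by apply: sumr_ge0 => i _; rewrite addr_ge0 ?sqr_ge0.
Qed.

Let W_eq0 w : W w = 0 -> U w = 0.
Proof.
rewrite /U /W /Y fold_add_termE/= => /eqP.
rewrite psumr_eq0 => [/allP X0|i _]; last by rewrite addr_ge0 ?sqr_ge0.
have X0' i : (X i w).1 = 0 /\ (X i w).2 = 0.
  have := X0 i; rewrite mem_enum => /(_ isT).
  by rewrite /= paddr_eq0 ?sqr_ge0// !sqrf_eq0 => /andP[/eqP ? /eqP ?].
rewrite /sqnorm/= !big1 ?expr0n ?addr0// => i _.
- by have [-> ->] := X0' i; rewrite !mul0r subr0.
- by have [-> ->] := X0' i; rewrite !mul0r addr0.
Qed.

Let mY : measurable_fun setT Y.
Proof. by apply: measurable_fold_rv => // j; exact: measurable_add_term. Qed.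

Let mW : measurable_fun setT (W : T -> R).
Proof. exact: measurableT_comp measurable_snd mY. Qed.

Let mU : measurable_fun setT (U : T -> R).
Proof.
have mY1 := measurableT_comp measurable_fst mY.
by apply: measurable_funD; apply: measurable_funX;
  [exact: measurableT_comp measurable_fst mY1|
   exact: measurableT_comp measurable_snd mY1].
Qed.

(** Equal to [exp(- t W) - exp(- t (W + q U))], factored to match the integrand of
    [frullani_integral]. *)
Let laplace_decrement (q t : R) (w : T) : R :=
  expR (- (t * W w)) * (1 - expR (- (t * (q * U w)))).

Let laplace_decrement_ge0 q t w : 0 <= q -> 0 <= t ->
  0 <= laplace_decrement q t w.
Proof.
move=> q0 t0; rewrite mulr_ge0 ?expR_ge0// subr_ge0 -expR0 ler_expR oppr_le0.
by rewrite !mulr_ge0.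
Qed.

Let measurable_laplace_decrement q :
  measurable_fun [set: T * measurableTypeR R]
    (fun z => laplace_decrement q z.2 z.1).
Proof.
have mW1 := measurableT_comp mW (@measurable_fst _ _ T (measurableTypeR R)).
have mU1 := measurableT_comp mU (@measurable_fst _ _ T (measurableTypeR R)).
have mt := @measurable_snd _ _ T (measurableTypeR R).
have mexpN (f : T * measurableTypeR R -> R) :
    measurable_fun setT f -> measurable_fun setT (fun z => expR (- f z)).
  move=> mf; exact: measurableT_comp (@measurable_expR R)
    (measurableT_comp (@oppr_measurable R _) mf).
apply: measurable_funM; first by apply: mexpN; apply: measurable_funM.
apply: measurable_funB; first exact: measurable_cst.
by apply: mexpN; apply: measurable_funM => //; apply: measurable_funM.
Qed.

(* If W w = 0 then U w = 0, and both sides vanish since U w / 0 = 0. *)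
Let ln1D_ratio (q : R) w : 0 <= q ->
  (\int[lebesgue_measure]_(t in `]0%R, +oo[) (laplace_decrement q t w / t)%:E =
   (ln (1 + q * (U w / W w)))%:E)%E.
Proof.
move=> q0; have [Ww0|Ww0] := eqVneq (W w) 0.
  rewrite W_eq0// mul0r mulr0 addr0 ln1; apply: integral0_eq => t _.
  by rewrite /laplace_decrement W_eq0// !mulr0 oppr0 expR0 subrr mulr0 mul0r.
by rewrite mulrA frullani_integral// ?mulr_ge0// lt_neqAle eq_sym Ww0 W0.
Qed.

Let integral_laplace_decrement (q t : R) : 0 < q -> 0 < S -> 0 < t ->
  (\int[P]_w (laplace_decrement q t w / t)%:E =
   (log_beta_integrand alpha (q * S) #|I|.-1 t)%:E)%E.
Proof.
move=> q0 S0 t0.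
(* A positive [S] rules out an empty family, so [#|I|.-1] is a genuine predecessor. *)
have I0 : (0 < #|I|)%N.
  rewrite lt0n; apply: contraTneq S0 => I0.
  by rewrite /S big_pred0 ?ltxx// => i; move: (card0_eq I0 i).
have mgw r : measurable_fun setT (fun w => (gauss_weight t r (Y w))%:E).
  apply/measurable_EFinP.
  exact: measurableT_comp (measurable_gauss_weight t r) mY.
have Lap r r0 := @integral_gauss_weight_fold R d T P I X v alpha t r (enum I)
  mX Xlaw indX (enum_uniq I) alpha0 (ltW t0) r0.
have mdec : measurable_fun setT (fun w => laplace_decrement q t w / t).
  apply: measurable_funM => //.
  exact: measurable_fun_pair1 (measurable_laplace_decrement q).
(* The difference of the two weights is again written as a sum of nonnegative terms; [solve] below
   isolates the unknown mean once the other two are known to be finite. *)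
have gwE w : (gauss_weight t 0 (Y w))%:E =
    ((t%:E * (laplace_decrement q t w / t)%:E)
     + (gauss_weight t (t * q) (Y w))%:E)%E.
  rewrite -EFinM -EFinD; congr EFin; rewrite /laplace_decrement /gauss_weight.
  rewrite -/(W w) -/(sqnorm (Y w).1) -/(U w).
  rewrite mul0r addr0 -(mulrA t q) opprD expRD.
  by field; rewrite gt_eqF.
have tq0 : 0 <= t * q by rewrite ltW// mulr_gt0.
have := Lap 0 (lexx 0); have := Lap _ tq0; rewrite -/Y.
under [in X in _ -> X -> _]eq_integral do rewrite gwE.
move=> Eb; rewrite ge0_integralD//; last 3 first.
- move=> w _; rewrite -EFinM lee_fin mulr_ge0 ?(ltW t0)//.
  by rewrite divr_ge0 ?laplace_decrement_ge0// ltW.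
- by apply/measurable_EFinP; apply: measurable_funM.
- by move=> w _; rewrite lee_fin expR_ge0.
rewrite ge0_integralZl//; last 3 first.
- apply/measurable_EFinP; exact: mdec.
- move=> w _; rewrite lee_fin.
  by rewrite divr_ge0 ?laplace_decrement_ge0// ltW.
- by rewrite lee_fin ltW.
rewrite Eb -cardE big_enum/= -/S => Ea.
have A1 : 0 < 1 + alpha * t by rewrite ltr_wpDr// mulr_ge0// ltW.
have B1 : 0 < 1 + alpha * (1 + q * S) * t.
  by rewrite ltr_wpDr// !mulr_ge0 ?addr_ge0// ?mulr_ge0// ltW.
have solve (x : \bar R) (a b : R) :
    (t%:E * x + b%:E = a%:E -> x = ((a - b) / t)%:E)%E.
  move=> E; have -> : (x = t^-1%:E * (t%:E * x))%E.
    by rewrite muleA -EFinM mulVf ?gt_eqF// mul1e.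
  by rewrite -(@addeK _ b%:E (t%:E * x)%E)// E -EFinB -EFinM mulrC.
rewrite (solve _ _ _ Ea); congr EFin.
have Am : (1 + alpha * t) ^+ #|I|.-1 != 0 by rewrite expf_neq0// gt_eqF.
rewrite /log_beta_integrand -[in LHS](prednK I0) !exprS.
have B2 : 1 + alpha * t + alpha * (t * q) * S != 0.
  by rewrite gt_eqF// ltr_wpDr// !mulr_ge0// ltW.
by field; rewrite Am !gt_eqF.
Qed.

(** Tonelli exchanges the expectation with the integral over [t]: for fixed [w] the inner integral
    is Frullani's, for fixed [t] it is a difference of Laplace transforms. *)
Lemma mean_log_ratio (c q : R) : 0 <= c -> 0 < q -> 0 < S ->
  (\int[P]_w (c * ln (1 + q * (U w / W w)))%:E =
   (c * log_beta_mean (q * S) #|I|.-1)%:E)%E.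
Proof.
move=> c0 q0 S0; pose D : set R := `]0%R, +oo[%classic.
have DE t : (t \in D) = (0 < t).
  by apply/idP/idP; rewrite inE /D/= in_itv/= andbT.
(* Extending [1 / t] by 0 to [t <= 0] moves the domain of integration into the integrand. *)
pose k : R -> R := (fun t => t^-1) \_ D.
have mk : measurable_fun [set: measurableTypeR R] k.
  apply/(measurable_restrictT _ _).1; first exact: measurable_itv.
  apply: open_continuous_measurable_fun => // t.
  by rewrite DE => t0; apply: inv_continuous; rewrite gt_eqF.
have k0 t : 0 <= k t.
  rewrite /k patchE; case: ifPn => //; rewrite DE => /ltW.
  by rewrite invr_ge0.
pose f (z : T * measurableTypeR R) := (k z.2 * laplace_decrement q z.2 z.1)%:E.
have mf : measurable_fun setT f.
  apply/measurable_EFinP; apply: measurable_funM.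
    exact: measurableT_comp mk measurable_snd.
  exact: measurable_laplace_decrement.
have kD t : 0 < t -> k t = t^-1.
  by move=> t0; rewrite /k patchE DE t0.
have kD0 t : t <= 0 -> k t = 0.
  by move=> t0; rewrite /k patchE DE ltNge t0.
have f0 z : (0 <= f z)%E.
  rewrite lee_fin; have [t0|t0] := leP z.2 0; first by rewrite kD0// mul0r.
  by rewrite mulr_ge0// laplace_decrement_ge0// ltW.
have fE w : fubini_F lebesgue_measure f w = (ln (1 + q * (U w / W w)))%:E.
  rewrite -ln1D_ratio ?(ltW q0)// integral_mkcond -/D.
  apply: eq_integral => t _.
  rewrite patchE DE /f/=; have [t0|t0] := leP t 0.
    by rewrite kD0// mul0r.
  by rewrite kD// mulrC.
have fE' t : fubini_G P f t =
    ((fun t => (log_beta_integrand alpha (q * S) #|I|.-1 t)%:E) \_ D) t.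
  rewrite patchE DE /fubini_G /f/=; have [t0|t0] := leP t 0.
    by apply: integral0_eq => w _; rewrite kD0// mul0r.
  rewrite -integral_laplace_decrement//.
  by apply: eq_integral => w _; rewrite kD// mulrC.
have mF := measurable_fun_fubini_tonelli_F (m2 := lebesgue_measure) f mf f0.
have F0 w : (0 <= fubini_F lebesgue_measure f w)%E by apply: integral_ge0.
under eq_integral do rewrite EFinM -fE.
rewrite ge0_integralZl// EFinM; congr (_ * _)%E.
rewrite (fubini_tonelli (m1 := P) (m2 := lebesgue_measure) f mf f0).
transitivity (\int[lebesgue_measure]_t
    ((fun t => (log_beta_integrand alpha (q * S) #|I|.-1 t)%:E) \_ D) t)%E.
  by apply: eq_integral => t _; exact: fE'.
by rewrite -integral_mkcond integral_log_beta_integrand// mulr_gt0.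
Qed.

End mean_log_ratio.

(** * From complex vectors to real coordinates, and the limit of the rate *)

Lemma sqr_modulus (R : realType) (z : R[i]) : modulus z ^+ 2 = sqnorm (reim z).
Proof.
by case: z => a b; rewrite /modulus /= sqr_sqrtr// addr_ge0 ?sqr_ge0.
Qed.

Lemma sqr_norm2 (R : realType) (M : nat) (h : 'cV[R[i]]_M) :
  norm2 h ^+ 2 = \sum_(i < M) sqnorm (reim (h i 0)).
Proof.
rewrite /norm2 sqr_sqrtr; last by apply: sumr_ge0 => i _; exact: sqr_ge0.
by apply: eq_bigr => i _; exact: sqr_modulus.
Qed.

Lemma sqr_norm2_gt0 (R : realType) (M : nat) (h : 'cV[R[i]]_M) :
  h != 0 -> 0 < norm2 h ^+ 2.
Proof.
move=> h0; rewrite lt_neqAle sqr_ge0 andbT eq_sym sqr_norm2.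
apply: contraNneq h0 => /eqP.
rewrite psumr_eq0 => [/allP H|i _]; last by rewrite addr_ge0 ?sqr_ge0.
apply/eqP/matrixP => i j; rewrite ord1 mxE.
have := H i (mem_index_enum i); rewrite /= paddr_eq0 ?sqr_ge0// !sqrf_eq0.
by case: (h i 0) => a b /= /andP[/eqP -> /eqP ->].
Qed.

Lemma reim_adjoint_mul (R : realType) (M : nat) (h v : 'cV[R[i]]_M) :
  let X i := reim (h i 0) in let Y i := reim (v i 0) in
  reim ((adjoint h *m v) 0 0) =
  (\sum_(i < M) ((X i).1 * (Y i).1 + (X i).2 * (Y i).2),
   \sum_(i < M) ((X i).1 * (Y i).2 - (X i).2 * (Y i).1)).
Proof.
rewrite mxE /reim !raddf_sum /=; congr (_, _); apply: eq_bigr => i _;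
  rewrite !mxE; case: (h i 0) (v i 0) => [a b] [a' b'] /=; ring.
Qed.

Unset Implicit Arguments.
Set Strict Implicit.

Theorem theorem3 (R : realType)
    (d : measure_display) (T : measurableType d) (P : probability T R)
    (M N L : nat) (alpha_c alpha_s : R)
    (hs : 'cV[R[i]]_M) (hc : T -> 'cV[R[i]]_M) :
  (1 <= M)%N -> (1 <= N)%N -> (1 <= L)%N ->
  0 < alpha_c -> 0 < alpha_s ->
  hs != 0 ->
  circular_gaussian_vector P alpha_c hc ->
  (cc_sensing_rate P N L alpha_s hs hc p -
   (L%:R^-1 *
     (log2 p + log2 (L%:R * N%:R * alpha_s * norm2 hs ^+ 2)
      - \sum_(1 <= i < M) 1 / (i%:R * ln 2)))%:E)%E @[p --> +oo] --> 0%E.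
Proof.
move=> M1 N1 L1 ac0 as0 hs0 [mX Xlaw indX].
have L0 : 0 < L%:R :> R by rewrite ltr0n.
have N0 : 0 < N%:R :> R by rewrite ltr0n.
have ln20 : 0 < ln 2 :> R by rewrite ln_gt0// ltr1n.
have S0 := sqr_norm2_gt0 hs0.
set c := L%:R * N%:R * alpha_s * norm2 hs ^+ 2.
have c0 : 0 < c.
  by rewrite /c pmulr_lgt0// !mulr_gt0.
(* An exact formula for every [p > 0]; the factor [1 / ln 2] comes from [log2]. *)
have rateE p : 0 < p -> cc_sensing_rate P N L alpha_s hs hc p =
    (L%:R^-1 / ln 2 * log_beta_mean (p * c) M.-1)%:E.
  move=> p0; rewrite /cc_sensing_rate unlock.
  have -> : p * c = p * N%:R * L%:R * alpha_s * norm2 hs ^+ 2.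
    by rewrite /c; ring.
  have q0 : 0 < p * N%:R * L%:R * alpha_s by rewrite !mulr_gt0.
  have := @mean_log_ratio R d T P 'I_M (fun i t => reim (hc t i 0))
    (fun i => reim (hs i 0)) alpha_c mX Xlaw indX ac0 (L%:R^-1 / ln 2)
    (p * N%:R * L%:R * alpha_s).
  rewrite -sqr_norm2 card_ord => <-//; last by rewrite divr_ge0 ?invr_ge0 ?ltW.
  apply: eq_integral => t _; congr EFin.
  rewrite fold_add_termE !big_enum/= -sqr_norm2 sqr_modulus reim_adjoint_mul.
  by rewrite /log2 [LHS]mulrA [LHS]mulrAC.
have main : L%:R^-1 / ln 2 * (log_beta_mean (p * c) M.-1 - ln (p * c)
    + \sum_(1 <= i < M) (i%:R : R)^-1) @[p --> +oo] --> (0 : R).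
  rewrite -[X in _ --> X](mulr0 (L%:R^-1 / ln 2)).
  apply: cvgM; first exact: cvg_cst.
  rewrite -[X in _ --> X](addNr (\sum_(1 <= i < M) (i%:R : R)^-1)).
  apply: cvgD; last exact: cvg_cst.
  (* As [M] is positive, the bound [M.-1.+1] of the sum is [M]; the limit is then taken along
     [k = p c]. *)
  have := @log_beta_mean_cvg R M.-1; rewrite prednK// => H.
  apply: (@cvg_comp _ _ _ (fun p => p * c)
    (fun k => log_beta_mean k M.-1 - ln k)) H.
  by apply: gt0_cvgMly => //; exact: cvg_id.
have : (L%:R^-1 / ln 2 * (log_beta_mean (p * c) M.-1 - ln (p * c)
    + \sum_(1 <= i < M) (i%:R : R)^-1))%:E @[p --> +oo] --> 0%E.
  by apply: cvg_EFin main; exact: nearW.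
(* The two expressions need only agree for large [p], where [rateE] applies and [ln (p c)] splits
   into [ln p + ln c]. *)
apply: cvg_trans; apply: near_eq_cvg; near=> p.
have p0 : 0 < p by near: p; exact: nbhs_pinfty_gt.
rewrite rateE// -EFinB; congr EFin.
rewrite /log2 [ln (p * c)]lnM ?posrE//.
have -> : \sum_(1 <= i < M) 1 / (i%:R * ln 2) =
    (\sum_(1 <= i < M) (i%:R : R)^-1) / ln 2.
  by rewrite mulr_suml; apply: eq_bigr => i _; rewrite div1r invfM.
by field; rewrite !gt_eqF.
Unshelve. all: by end_near. Qed.
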